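(* Let $D$ be a strong digraph of order $n$ and diameter $d$. Then (i) $smc_v(D)=n$ if and only if $d\le 2$; (ii) if $d\ge 3$, then $smc_v(D)\le n-d+2$.
   Context: All digraphs are simple (no parallel arcs and no loops); all paths are directed. A digraph is strong (strongly connected) if for every pair of vertices $u,v$, each is reachable from the other. The diameter is the maximum of the directed distances $d(u,v)$ over ordered pairs of vertices. A directed path in a vertex-colored digraph is vertex-monochromatic if all its internal vertices have the same color (so paths with at most one internal vertex are always vertex-monochromatic). A vertex-coloring (not necessarily proper) of a strong digraph is an SVMC-coloring if for every pair $u,v$ of vertices there exist a directed $(u,v)$-vertex-monochromatic path and a directed $(v,u)$-vertex-monochromatic path. $smc_v(D)$ denotes the maximum number of colors used in an SVMC-coloring of the strong digraph $D$. *)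

(* Defs.v *)
From mathcomp Require Import all_boot.

Set Implicit Arguments.
Unset Strict Implicit.
Unset Printing Implicit Defensive.

(* A simple digraph is an irreflexive relation [e] on a finite type [T] of
   vertices, [e u v] meaning that there is an arc from u to v. *)

Section Digraph.
Variables (T : finType) (e : rel T).

Definition strong : Prop := forall u v : T, connect e u v.

(* As in path.v, the vertex sequence of the path is u :: p; its length is
   [size p], which is less than #|T| since the vertices are distinct. *)
Definition dipath (u v : T) (p : seq T) : bool :=
  [&& path e u p, last u p == v & uniq (u :: p)].

(* #|T| exceeds the length of every path: it is the (junk) value of the
   distance to an unreachable vertex. *)
Definition distance (u v : T) : nat :=
  \big[minn/#|T|]_(p : #|T|.-bseq T | dipath u v p) size p.

Definition diameter : nat := \max_(u : T) \max_(v : T) distance u v.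

Definition internal (u : T) (p : seq T) : seq T := behead (belast u p).

Definition vmono (C : eqType) (c : T -> C) (u : T) (p : seq T) : bool :=
  constant (map c (internal u p)).

Definition vmono_connected (C : eqType) (c : T -> C) (u v : T) : bool :=
  [exists p : #|T|.-bseq T, dipath u v p && vmono c u p].

Definition svmc_coloring (C : eqType) (c : T -> C) : bool :=
  [forall u, forall v, vmono_connected c u v && vmono_connected c v u].

(* A coloring uses at most #|T| colors, so the palette 'I_#|T| is sufficient:
   see [smcv_ub]. *)
Definition smcv : nat :=
  \max_(c : {ffun T -> 'I_#|T|} | svmc_coloring c) #|[set c x | x : T]|.

Lemma constant_map_eq (C C' : eqType) (c : T -> C) (c' : T -> C') (s : seq T) :
  (forall x y, c x = c y -> c' x = c' y) ->
  constant (map c s) -> constant (map c' s).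
Proof.
move=> h; case: s => [|x s] //= /allP hs; apply/allP=> _ /mapP[y ys ->].
by apply/eqP/h/eqP/hs/map_f.
Qed.

Lemma smcv_ub (C : finType) (c : T -> C) :
  svmc_coloring c -> #|[set c x | x : T]| <= smcv.
Proof.
move=> hc; pose r x := odflt x [pick y | c y == c x].
have cr x : c (r x) = c x.
  by rewrite /r; case: pickP => [y /eqP|/(_ x)] //=; rewrite eqxx.
have rP x y : c x = c y -> r x = r y.
  move=> exy; rewrite /r exy; case: pickP => //= /(_ y).
  by rewrite eqxx.
pose c' := [ffun x => enum_rank (r x)].
have c'P x y : c x = c y -> c' x = c' y by rewrite !ffunE => /rP->.
have mP u v : vmono_connected c u v -> vmono_connected c' u v.
  case/existsP=> p /andP[hp hm]; apply/existsP; exists p; rewrite hp.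
  exact: constant_map_eq hm.
have hc' : svmc_coloring c'.
  apply/forallP=> u; apply/forallP=> v.
  by have /forallP/(_ u)/forallP/(_ v)/andP[/mP-> /mP->] := hc.
apply: leq_trans (leq_bigmax_cond _ hc').
have -> : [set c x | x : T] = [set c (enum_val i) | i in [set c' x | x : T]].
  rewrite -imset_comp; apply: eq_imset => x /=.
  by rewrite ffunE enum_rankK cr.
exact: leq_imset_card.
Qed.

End Digraph.

(* Main.v *)
Require Import Defs.
From mathcomp Require Import all_boot.

(** The whole proposition follows from one inequality: an SVMC-coloring with
k colors of a digraph with n vertices and diameter d satisfies k + d <= n + 2
([svmc_coloring_diameter], [smcv_diameter]).  To see it, take vertices u and v
at distance at least 2.  A vertex-monochromatic path from u to v has at least
d(u,v) - 1 internal vertices; these are distinct and share one color, so at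
least d(u,v) - 2 of the n conceivable colors are lost ([card_imset_constant]).
Smaller distances impose nothing, because k <= n.  The inequality gives (ii),
and it also forces d <= 2 as soon as n colors are used.

Conversely, when d <= 2, a shortest path has at most one internal vertex and
hence is vertex-monochromatic whatever the coloring; in a strong digraph the
coloring that gives each vertex its own color is then an SVMC-coloring. *)

(** Repetitions of a color are lost colors: the elements of [s] contribute at
most one color, and each of the other elements of [T] at most one more. *)
Lemma card_imset_constant (T C : finType) (c : T -> C) (s : seq T) :
  uniq s -> constant (map c s) -> #|[set c x | x : T]| + size s <= #|T| + 1.
Proof.
move=> us cs; pose S := [set x in s].
have cS : #|c @: S| <= 1.
  rewrite {}/S; case: s cs {us} => [|x s] /= cs.
    by rewrite set_nil imset0 cards0.
  rewrite -(cards1 (c x)); apply/subset_leq_card/subsetP=> _ /imsetP[y yS ->].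
  rewrite inE; move: yS; rewrite !inE => /orP[/eqP->//|ys].
  by move/allP: cs; apply; apply: map_f.
have -> : [set c x | x : T] = c @: S :|: c @: ~: S.
  rewrite -imsetU setUCr; apply/setP=> y.
  by apply/imsetP/imsetP=> -[x _ ->]; exists x; rewrite ?inE.
have <- : #|S| = size s by rewrite cardsE; apply/card_uniqP.
rewrite -(cardsC S) addnC -addnA leq_add2l addnC.
apply: leq_trans (leq_card_setU _ _) _.
by rewrite leq_add // leq_imset_card.
Qed.

Section Distance.
Variables (T : finType) (e : rel T).

Lemma distance_leq (u v : T) (p : #|T|.-bseq T) :
  dipath e u v p -> distance e u v <= size p.
Proof.
move=> up; rewrite /distance.
elim: (index_enum _) (mem_index_enum p) => // q r IHr.
rewrite inE big_cons => /orP[/eqP<-|/IHr le_r]; first by rewrite up geq_minl.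
by case: ifP => // _; apply: leq_trans (geq_minr _ _) le_r.
Qed.

Lemma distance_leq_card (u v : T) : distance e u v <= #|T|.
Proof.
by apply: (big_ind (leq^~ #|T|)) => // [m n lem _|p _];
  [rewrite geq_min lem | apply: size_bseq].
Qed.

Lemma diameter_leq_card : diameter e <= #|T|.
Proof.
by apply/bigmax_leqP=> u _; apply/bigmax_leqP=> v _; apply: distance_leq_card.
Qed.

Lemma distance_leq_diameter (u v : T) : distance e u v <= diameter e.
Proof.
apply: leq_trans (leq_bigmax u).
exact: (leq_bigmax (F := fun w => distance e u w)).
Qed.

(** A minimum is attained or equal to the default value [#|T|]; the latter is
excluded by reachability, since a path without repetition is shorter. *)
Lemma distance_attained (u v : T) : connect e u v ->
  exists2 p : #|T|.-bseq T, dipath e u v p & size p = distance e u v.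
Proof.
case/connectP=> p0 /shortenP[p ep up _] vp.
have lt_p : size p < #|T|
  by rewrite -[_.+1]/(size (u :: p)) -(card_uniqP up) max_card.
have dp : dipath e u v (Bseq (ltnW lt_p)) by apply/and3P; split; rewrite // vp.
have lt_d : distance e u v < #|T| := leq_ltn_trans (distance_leq _ _ _ dp) lt_p.
suff [dE|//] : distance e u v = #|T| \/
    exists2 q : #|T|.-bseq T, dipath e u v q & size q = distance e u v.
  by rewrite dE ltnn in lt_d.
rewrite /distance; elim/big_rec: _ => [|q m dq IHm]; first by left.
by rewrite /minn; case: ifP => _ //; right; exists q.
Qed.

Lemma size_internal (u : T) (p : seq T) : size (internal u p) = (size p).-1.
Proof. by rewrite size_behead size_belast. Qed.

Lemma internal_uniq (u v : T) (p : seq T) :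
  dipath e u v p -> uniq (internal u p).
Proof.
case/and3P=> _ _; rewrite lastI rcons_uniq => /andP[_].
by rewrite /internal; case: (belast u p) => //= x s /andP[].
Qed.

Lemma svmc_coloring_diameter (C : finType) (c : T -> C) :
  svmc_coloring e c -> #|[set c x | x : T]| + diameter e <= #|T| + 2.
Proof.
move=> hc; have le_k : #|[set c x | x : T]| <= #|T| + 2.
  by apply: leq_trans (leq_imset_card _ _) _; rewrite leq_addr.
rewrite -leq_subRL //.
apply/bigmax_leqP=> u _; apply/bigmax_leqP=> v _; rewrite leq_subRL //.
have /andP[/existsP[p /andP[dp mp]] _] := forallP (forallP hc u) v.
have := card_imset_constant _ _ _ _ (internal_uniq _ _ _ dp) mp.
rewrite size_internal => le_kp.
(* The successor of the predecessor covers the empty path from u = v, which,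
   like a single arc, has no internal vertex. *)
have le_d : distance e u v <= (size p).-1.+1.
  exact: leq_trans (distance_leq _ _ _ dp) (leqSpred _).
by apply: leq_trans (leq_add (leqnn _) le_d) _; rewrite addnS [_ + 2]addnS.
Qed.

(** Since d <= n, the truncated difference n + 2 - d that bounds each coloring
also bounds the maximum without loss. *)
Lemma smcv_diameter : smcv e + diameter e <= #|T| + 2.
Proof.
have le_d : diameter e <= #|T| + 2.
  by apply: leq_trans diameter_leq_card _; rewrite leq_addr.
rewrite addnC -leq_subRL //; apply/bigmax_leqP=> c hc.
by rewrite leq_subRL // addnC svmc_coloring_diameter.
Qed.

Lemma smcv_leq_card : smcv e <= #|T|.
Proof. by apply/bigmax_leqP=> c _; apply: leq_imset_card. Qed.

(** Shortest paths have at most one internal vertex, so no coloring can break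
their monochromaticity. *)
Lemma svmc_coloring_diameter2 (C : eqType) (c : T -> C) :
  strong e -> diameter e <= 2 -> svmc_coloring e c.
Proof.
move=> he d2.
suff conn u v : vmono_connected e c u v.
  by apply/forallP=> u; apply/forallP=> v; rewrite !conn.
have [p dp sp] := distance_attained _ _ (he u v).
apply/existsP; exists p; rewrite dp /= /vmono.
have : size (internal u p) <= 1.
  rewrite size_internal -subn1 leq_subLR sp.
  exact: leq_trans (distance_leq_diameter u v) d2.
by case: (internal u p) => [|x []].
Qed.

End Distance.

Theorem proposition1 (T : finType) (D : rel T) (n d : nat)
    (hsimple : irreflexive D) (hstrong : strong D)
    (hn : #|T| = n) (hd : diameter D = d) :
  (smcv D = n <-> d <= 2) /\ (3 <= d -> smcv D <= n - d + 2).
Proof.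
have := smcv_diameter _ D; rewrite hn hd => bound.
split; last first.
  move=> _; have le_dn : d <= n by rewrite -hn -hd diameter_leq_card.
  by rewrite -(leq_add2r d) addnAC subnK.
split=> [kn|d2]; first by rewrite kn leq_add2l in bound.
apply/eqP; rewrite eqn_leq -{1 2}hn smcv_leq_card /=.
(* Every vertex is its own color. *)
have hid : svmc_coloring D (@id T).
  by apply: svmc_coloring_diameter2; rewrite ?hd.
by have := smcv_ub hid; rewrite card_imset // hn.
Qed.
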